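(* Let $E$ and $F$ be Banach lattices. The following assertions are equivalent: (1) Each positive Dunford–Pettis operator $T:E\to F$ is uaw-Dunford–Pettis. (2) Each positive compact operator $T:E\to F$ is uaw-Dunford–Pettis. (3) Either the norm of the dual Banach lattice $E'$ is order continuous, or $F=\{0\}$.
   Context: All operators are continuous linear operators. A net $(x_\alpha)$ in a Banach lattice $E$ is uaw-convergent to $x$ (written $x_\alpha\xrightarrow{uaw}x$) if $|x_\alpha-x|\wedge u\to 0$ weakly for every $u\in E_+$. An operator $T$ from a Banach lattice $E$ into a Banach space $X$ is uaw-Dunford–Pettis if for every norm bounded sequence $(x_n)$ in $E$ with $x_n\xrightarrow{uaw}0$ one has $\|Tx_n\|\to 0$. An operator between Banach spaces is Dunford–Pettis if it maps weakly null sequences to norm null sequences. *)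

(* Defs.v *)
From HB Require Import structures.
From mathcomp Require Import all_boot all_order all_algebra.
From mathcomp Require Import all_classical all_reals all_analysis.
Set Implicit Arguments. Unset Strict Implicit. Unset Printing Implicit Defensive.
Import Order.TTheory GRing.Theory Num.Theory.
Import numFieldNormedType.Exports.
Local Open Scope classical_set_scope.
Local Open Scope ring_scope.

Record banach_lattice (R : realType) (E : completeNormedModType R) := BanachLattice {
  bl_le : E -> E -> Prop;
  bl_sup : E -> E -> E;
  bl_refl : forall x, bl_le x x;
  bl_antisym : forall x y, bl_le x y -> bl_le y x -> x = y;
  bl_trans : forall x y z, bl_le x y -> bl_le y z -> bl_le x z;
  bl_add : forall x y z, bl_le x y -> bl_le (x + z) (y + z);
  bl_scale : forall (a : R) x y, 0 <= a -> bl_le x y -> bl_le (a *: x) (a *: y);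
  bl_sup_ubl : forall x y, bl_le x (bl_sup x y);
  bl_sup_ubr : forall x y, bl_le y (bl_sup x y);
  bl_sup_least : forall x y z, bl_le x z -> bl_le y z -> bl_le (bl_sup x y) z;
  bl_norm_mono : forall x y, bl_le (bl_sup x (- x)) (bl_sup y (- y)) -> `|x| <= `|y|
}.

Section BL.
Variables (R : realType) (E : completeNormedModType R).

Definition bl_inf (L : banach_lattice E) (x y : E) : E := - bl_sup L (- x) (- y).
Definition bl_abs (L : banach_lattice E) (x : E) : E := bl_sup L x (- x).

Definition is_dual (f : E -> R) : Prop :=
  (forall (a : R) (x y : E), f (a *: x + y) = a * f x + f y) /\ continuous f.

Definition dual_norm (f : E -> R) : R := sup [set `|f x| | x in [set x : E | `|x| <= 1]].

Definition dual_le (L : banach_lattice E) (f g : E -> R) : Prop :=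
  forall x, bl_le L 0 x -> f x <= g x.

Definition dual_order_continuous (L : banach_lattice E) : Prop :=
  forall (I : Type) (leI : I -> I -> Prop) (f : I -> E -> R),
    (exists i : I, True) ->
    (forall i, leI i i) ->
    (forall i j k, leI i j -> leI j k -> leI i k) ->
    (forall i j, exists k, leI i k /\ leI j k) ->
    (forall i, is_dual (f i)) ->
    (forall i j, leI i j -> dual_le L (f j) (f i)) ->
    (forall i, dual_le L (fun _ => 0) (f i)) ->
    (forall g, is_dual g -> (forall i, dual_le L g (f i)) -> dual_le L g (fun _ => 0)) ->
    forall eps : R, 0 < eps -> exists i0, forall i, leI i0 i -> dual_norm (f i) < eps.

Definition weakly_null (x : nat -> E) : Prop :=
  forall f : E -> R, is_dual f -> (fun n => f (x n)) @ \oo --> (0 : R).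

Definition uaw_null (L : banach_lattice E) (x : nat -> E) : Prop :=
  forall u : E, bl_le L 0 u -> weakly_null (fun n => bl_inf L (bl_abs L (x n)) u).

End BL.

Section Ops.
Variables (R : realType) (E F : completeNormedModType R).

Definition positive_op (LE : banach_lattice E) (LF : banach_lattice F) (T : E -> F) : Prop :=
  forall x, bl_le LE 0 x -> bl_le LF 0 (T x).

Definition dunford_pettis (T : E -> F) : Prop :=
  forall x : nat -> E, weakly_null x -> (fun n => T (x n)) @ \oo --> (0 : F).

Definition compact_op (T : E -> F) : Prop :=
  compact (closure (T @` [set x : E | `|x| <= 1])).

Definition uaw_dunford_pettis (LE : banach_lattice E) (T : E -> F) : Prop :=
  forall x : nat -> E, (exists M : R, forall n, `|x n| <= M) -> uaw_null LE x ->
    (fun n => `|T (x n)|) @ \oo --> (0 : R).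

End Ops.

(* Main.v *)
(* Both directions pass through almost order boundedness of the unit ball of E:
   for every positive functional f and e > 0 there is u >= 0 with
   f((x - u)^+) <= e for all x >= 0 in the unit ball. This is equivalent to order
   continuity of E'.
   If E' is order continuous, subtract from f its restrictions to the principal
   ideals, a decreasing net with infimum 0, to reduce to a functional h carried by
   the ideal of one u. If the h((x_n - 2^n u)^+) stayed above e for some x_n in the
   ball, the restrictions of h to the ideals generated by (x_m - 2^m u)^+, m >= n,
   would decrease to 0 pointwise but not in norm.
   Under almost order boundedness, bounded uaw-null sequences are weakly null, and
   compact operators send these to norm null sequences.
   If almost order boundedness fails for f, a recursive choice gives x_n in the ball
   such that z_n = (x_n - 2^n (x_0 + ... + x_(n-1)))^+ satisfies f(z_n) > e and
   sum_(i < n) (z_i /\ u) <= u + sum_(i < n) 2^-i x_i for all u >= 0. So (z_n) is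
   uaw-null, and the rank one operator x |-> f(x) y, y > 0, is not
   uaw-Dunford-Pettis. *)
Require Import Defs.
From HB Require Import structures.
From mathcomp Require Import all_boot all_order all_algebra.
From mathcomp Require Import ring lra.
From mathcomp Require Import all_classical all_reals all_analysis.
Import Order.TTheory GRing.Theory Num.Theory.
Import numFieldNormedType.Exports.
Local Open Scope classical_set_scope.
Local Open Scope ring_scope.

(** * Vector lattices *)

Section vector_lattice.
Set Implicit Arguments. Unset Strict Implicit.
Context {R : realType} {E : completeNormedModType R} (L : banach_lattice E).

Local Notation "x '<=L' y" := (bl_le L x y) (at level 70, y at next level).
Local Notation inf := (bl_inf L).
Local Notation abs := (bl_abs L).

Definition bl_pos (x : E) : E := bl_sup L x 0.
Local Notation pos := bl_pos.

Lemma bl_leD x y z t : x <=L y -> z <=L t -> x + z <=L y + t.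
Proof.
move=> xy zt; apply: (bl_trans (y := y + z)); first exact: bl_add.
by rewrite ![y + _]addrC; apply: bl_add.
Qed.

Lemma bl_subr_ge0 x y : 0 <=L y - x <-> x <=L y.
Proof.
split=> [/(@bl_add _ _ L _ _ x)|/(@bl_add _ _ L _ _ (- x))].
  by rewrite add0r subrK.
by rewrite subrr.
Qed.

Lemma bl_lerBlDr x y z : x - z <=L y <-> x <=L y + z.
Proof.
by split=> [/(@bl_add _ _ L _ _ z)|/(@bl_add _ _ L _ _ (- z))]; rewrite ?subrK ?addrK.
Qed.

Lemma bl_leN x y : x <=L y -> - y <=L - x.
Proof. by move=> xy; apply/bl_subr_ge0; rewrite opprK addrC; apply/bl_subr_ge0. Qed.

Lemma bl_addr_ge0 x y : 0 <=L x -> 0 <=L y -> 0 <=L x + y.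
Proof. by move=> x0 y0; rewrite -[0](addr0 0); apply: bl_leD. Qed.

Lemma bl_scale_ge0 (a : R) x : 0 <= a -> 0 <=L x -> 0 <=L a *: x.
Proof. by move=> a0 x0; rewrite -(scaler0 _ a); apply: bl_scale. Qed.

Lemma bl_ler_addl x y : 0 <=L y -> x <=L x + y.
Proof. by move=> y0; rewrite -{1}[x]addr0; apply: bl_leD => //; apply: bl_refl. Qed.

Lemma bl_ler_addr x y : 0 <=L y -> x <=L y + x.
Proof. by rewrite addrC; apply: bl_ler_addl. Qed.

Lemma bl_sum_ge0 (x : nat -> E) m n :
  (forall i, 0 <=L x i) -> 0 <=L \sum_(m <= i < n) x i.
Proof.
by move=> x0; elim/big_ind: _ => //; [exact: bl_refl|exact: bl_addr_ge0].
Qed.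

Lemma bl_supC x y : bl_sup L x y = bl_sup L y x.
Proof.
by apply: (bl_antisym (b := L)); apply: bl_sup_least; (apply: bl_sup_ubr || apply: bl_sup_ubl).
Qed.

Lemma bl_supD x y z : bl_sup L (x + z) (y + z) = bl_sup L x y + z.
Proof.
apply: (bl_antisym (b := L)).
  by apply: bl_sup_least; apply: bl_add; [exact: bl_sup_ubl|exact: bl_sup_ubr].
apply/bl_subr_ge0; rewrite opprD addrCA addrC; apply/bl_subr_ge0.
by apply: bl_sup_least; [rewrite -{1}[x](addrK z)|rewrite -{1}[y](addrK z)];
  apply: bl_add; [exact: bl_sup_ubl|exact: bl_sup_ubr].
Qed.

Lemma bl_infl x y : inf x y <=L x.
Proof. by rewrite -{2}[x]opprK; apply: bl_leN; apply: bl_sup_ubl. Qed.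

Lemma bl_infr x y : inf x y <=L y.
Proof. by rewrite -{2}[y]opprK; apply: bl_leN; apply: bl_sup_ubr. Qed.

Lemma bl_inf_greatest x y z : z <=L x -> z <=L y -> z <=L inf x y.
Proof.
by move=> zx zy; rewrite -[z]opprK; apply: bl_leN; apply: bl_sup_least; apply: bl_leN.
Qed.

Lemma bl_infC x y : inf x y = inf y x.
Proof. by rewrite /bl_inf bl_supC. Qed.

Lemma bl_inf_mono x y z t : x <=L z -> y <=L t -> inf x y <=L inf z t.
Proof.
move=> xz yt; apply: bl_inf_greatest.
  exact: (bl_trans (bl_infl x y)).
exact: (bl_trans (bl_infr x y)).
Qed.

Lemma bl_inf_ge0 x y : 0 <=L x -> 0 <=L y -> 0 <=L inf x y.
Proof. exact: bl_inf_greatest. Qed.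

Lemma bl_infD x y z : inf (x + z) (y + z) = inf x y + z.
Proof. by rewrite /bl_inf !opprD bl_supD opprD opprK. Qed.

Lemma bl_pos_ge0 x : 0 <=L pos x.
Proof. exact: bl_sup_ubr. Qed.

Lemma bl_le_pos x : x <=L pos x.
Proof. exact: bl_sup_ubl. Qed.

Lemma bl_pos_le x y : x <=L y -> 0 <=L y -> pos x <=L y.
Proof. exact: bl_sup_least. Qed.

Lemma bl_pos_subN x : x = pos x - pos (- x).
Proof.
apply/eqP; rewrite eq_sym subr_eq addrC /bl_pos -bl_supD addNr add0r.
by rewrite bl_supC.
Qed.

(** Splits [x] into a part truncated at [y] and the excess over [y]. Later estimates control the two
    parts separately. *)
Lemma bl_inf_add_pos x y : x = inf x y + pos (x - y).
Proof.
by rewrite /bl_pos -[0](addNr x) [x - y]addrC bl_supD bl_supC addrA /bl_inf addNr add0r.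
Qed.

Lemma bl_sup_pos x y : bl_sup L x y = pos (x - y) + y.
Proof. by rewrite /bl_pos -bl_supD subrK add0r. Qed.

Lemma bl_sup_add_inf x y : bl_sup L x y + inf x y = x + y.
Proof. by rewrite bl_sup_pos [X in _ = X + y](bl_inf_add_pos x y) addrAC [pos _ + _]addrC. Qed.

(** Since [pos x = x + pos (- x)], translation reduces the infimum to [inf x 0 + pos (- x)], and
    [inf x 0] is [- pos (- x)]. *)
Lemma bl_pos_disjoint x : inf (pos x) (pos (- x)) = 0.
Proof.
have -> : pos x = x + pos (- x) by rewrite {2}[x]bl_pos_subN subrK.
rewrite -{2}[pos (- x)]add0r bl_infD /bl_inf oppr0.
by rewrite -/(pos (- x)) addNr.
Qed.

Lemma bl_infZ_le (a : R) x y : 0 < a -> inf (a *: x) (a *: y) <=L a *: inf x y.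
Proof.
move=> a0; set z := inf _ _.
rewrite -[z](scalerKV (lt0r_neq0 a0)); apply: bl_scale; first exact: ltW.
have ai : 0 <= a^-1 by rewrite invr_ge0 ltW.
apply: bl_inf_greatest.
  by rewrite -[x](scalerK (lt0r_neq0 a0)); apply: bl_scale => //; apply: bl_infl.
by rewrite -[y](scalerK (lt0r_neq0 a0)); apply: bl_scale => //; apply: bl_infr.
Qed.

Lemma bl_scale_mono (a b : R) x : a <= b -> 0 <=L x -> a *: x <=L b *: x.
Proof.
by move=> ab x0; apply/bl_subr_ge0; rewrite -scalerBl; apply: bl_scale_ge0; rewrite ?subr_ge0.
Qed.

Lemma bl_inf_disjointZ (a b : R) p q : 0 <= a -> 0 <= b -> 0 <=L p -> 0 <=L q ->
  inf p q = 0 -> inf (a *: p) (b *: q) <=L 0.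
Proof.
move=> a0 b0 p0 q0 pq.
(* A common factor that dominates both [a] and [b]; the summand 1 keeps it positive when both
   vanish. *)
have m0 : 0 < a + b + 1 by rewrite ltr_wpDl ?addr_ge0.
apply: (bl_trans (y := inf ((a + b + 1) *: p) ((a + b + 1) *: q))).
  apply: bl_inf_mono; apply: bl_scale_mono => //.
    by rewrite -addrA lerDl addr_ge0.
  by rewrite addrAC lerDr addr_ge0.
by apply: (bl_trans (bl_infZ_le _ _ m0)); rewrite pq scaler0; apply: bl_refl.
Qed.

Lemma bl_inf_subadd x y v : 0 <=L x -> 0 <=L y -> 0 <=L v ->
  inf (x + y) v <=L inf x v + inf y v.
Proof.
move=> x0 y0 v0; rewrite -bl_infD; apply: bl_inf_greatest.
  rewrite [x + inf _ _]addrC -bl_infD; apply: bl_inf_greatest.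
    by rewrite [y + x]addrC; apply: bl_infl.
  by apply: (bl_trans (bl_infr _ _)); apply: bl_ler_addl.
apply: (bl_trans (bl_infr _ _)); apply: bl_ler_addl.
exact: bl_inf_ge0.
Qed.

Lemma bl_disjoint_add_le p q r : inf p q <=L 0 -> p <=L r -> q <=L r -> p + q <=L r.
Proof.
move=> pq pr qr; rewrite -bl_sup_add_inf -[r]addr0; apply: bl_leD => //.
exact: bl_sup_least.
Qed.

Lemma bl_inf_sum x (y : nat -> E) m n : 0 <=L x -> (forall i, 0 <=L y i) ->
  inf x (\sum_(m <= i < n) y i) <=L \sum_(m <= i < n) inf x (y i).
Proof.
move=> x0 y0; elim: n => [|n IH].
  by rewrite !big_geq //; apply: bl_infr.
have [mn|nm] := leqP m n; last by rewrite !big_geq //; apply: bl_infr.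
rewrite !big_nat_recr //= bl_infC.
apply: (bl_trans (bl_inf_subadd _ _ _)) => //; first exact: bl_sum_ge0.
by apply: bl_leD; rewrite bl_infC //; apply: bl_refl.
Qed.

(* Where [x] exceeds [v], the function [c v] is below [c x]; elsewhere
   [(x - v)^+] vanishes. *)
Lemma bl_infZ_pos_le (c j : R) x v : 0 <= c -> 0 <= j -> 0 <=L x -> 0 <=L v ->
  inf (c *: v) (j *: pos (x - v)) <=L c *: x.
Proof.
move=> c0 j0 x0 v0.
have p0 y : 0 <=L pos y by exact: bl_pos_ge0.
apply: (bl_trans (y := inf (c *: x + c *: pos (v - x)) (j *: pos (x - v)))).
  apply: bl_inf_mono; last exact: bl_refl.
  rewrite -scalerDr; apply: bl_scale => //.
  by rewrite addrC; apply/bl_lerBlDr; apply: bl_le_pos.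
apply: (bl_trans (bl_inf_subadd _ _ _)); try exact: bl_scale_ge0.
rewrite -[X in _ <=L X]addr0; apply: bl_leD; first exact: bl_infl.
by apply: bl_inf_disjointZ => //; rewrite -[x - v]opprB; apply: bl_pos_disjoint.
Qed.

(* [(b - K a)^+] lives where [a] is below [K^-1 b], which lets [p] absorb the
   new term. *)
Lemma bl_add_inf_pos_le (K : R) a b p s u : 0 < K -> 0 <=L b -> 0 <=L u ->
  u <=L p -> s <=L a -> s <=L p ->
  s + inf (pos (b - K *: a)) u <=L p + K^-1 *: b.
Proof.
move=> K0 b0 u0 up sa sp.
have p0 : 0 <=L p by exact: (bl_trans u0).
have Kb : 0 <=L K^-1 *: b by apply: bl_scale_ge0 => //; rewrite invr_ge0 ltW.
set d := a - K^-1 *: b.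
have -> : pos (b - K *: a) = pos (K *: (- d)).
  by congr pos; rewrite opprB scalerBr scalerKV ?lt0r_neq0.
have posK : pos (K *: - d) <=L K *: pos (- d).
  apply: bl_pos_le; first by apply: bl_scale; [exact: ltW|exact: bl_le_pos].
  by apply: bl_scale_ge0; [exact: ltW|exact: bl_pos_ge0].
(* As [s <= a = d + K^-1 b], the vector [s] exceeds [K^-1 b] by at most [d^+], while the new term
   lives on [(- d)^+]. These are disjoint, so two pieces below [p] have their sum below [p]. *)
apply: (bl_trans (y := (inf (pos d) p + inf (pos (K *: - d)) u) + K^-1 *: b)).
  rewrite addrAC; apply: bl_add; apply/bl_lerBlDr; apply: bl_inf_greatest.
    by apply: (bl_trans (bl_add _ sa)); apply: bl_le_pos.
  by apply/bl_lerBlDr; apply: (bl_trans sp); apply: bl_ler_addl.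
apply: bl_add; apply: bl_disjoint_add_le; last 2 first.
- exact: bl_infr.
- exact: (bl_trans (bl_infr _ _)).
apply: (bl_trans (y := inf (1 *: pos d) (K *: pos (- d)))).
  rewrite scale1r; apply: bl_inf_mono; first exact: bl_infl.
  exact: (bl_trans (bl_infl _ _)).
by apply: bl_inf_disjointZ; rewrite ?ler01 ?bl_pos_disjoint ?(ltW K0) //; apply: bl_pos_ge0.
Qed.

Lemma bl_abs_ge0 x : 0 <=L abs x.
Proof.
have abs2 : 0 <=L abs x + abs x.
  by rewrite -[0](subrr x); apply: bl_leD; [exact: bl_sup_ubl|exact: bl_sup_ubr].
have -> : abs x = 2^-1 *: (abs x + abs x) by rewrite scalerDr -scalerDl [_ + _](_ : _ = 1) ?scale1r //; lra.
by apply: bl_scale_ge0; rewrite ?invr_ge0.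
Qed.

Lemma bl_abs_id x : 0 <=L x -> abs x = x.
Proof.
move=> x0; apply: (bl_antisym (b := L)); last exact: bl_sup_ubl.
apply: bl_sup_least; first exact: bl_refl.
by apply: (bl_trans (y := 0)) => //; rewrite -[0]oppr0; apply: bl_leN.
Qed.

Lemma bl_norm_le x y : 0 <=L x -> x <=L y -> `|x| <= `|y|.
Proof.
move=> x0 xy; apply: (@bl_norm_mono _ _ L); rewrite -!/(abs _) !bl_abs_id //.
exact: (bl_trans x0).
Qed.

Lemma bl_norm_abs x : `|abs x| = `|x|.
Proof.
have aa : abs (abs x) = abs x by apply: bl_abs_id; apply: bl_abs_ge0.
by apply/eqP; rewrite eq_le; apply/andP; split;
  apply: (@bl_norm_mono _ _ L); rewrite -!/(abs _) aa; apply: bl_refl.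
Qed.

Lemma bl_norm_pos x : `|pos x| <= `|x|.
Proof.
rewrite -(bl_norm_abs x); apply: bl_norm_le; first exact: bl_pos_ge0.
by apply: bl_pos_le; [exact: bl_sup_ubl|exact: bl_abs_ge0].
Qed.

End vector_lattice.

(** * Functionals on a Banach lattice *)

Section functionals.
Set Implicit Arguments. Unset Strict Implicit.
Context {R : realType} {E : completeNormedModType R}.
Implicit Types (f g : E -> R) (x y : E).

Lemma is_dual_intro f (M : R) : (forall (a : R) x y, f (a *: x + y) = a * f x + f y) ->
  (forall x, `|f x| <= M * `|x|) -> is_dual f.
Proof.
move=> flin fM; split=> // x.
have fB y : f y = f x + f (y - x).
  by have := flin 1 (y - x) x; rewrite scale1r subrK mul1r addrC.
have M0 : 0 < `|M| + 1 by rewrite ltr_wpDl.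
apply/cvgrPdist_lt => e e0; near=> y.
rewrite (fB y) opprD addNKr normrN (le_lt_trans (fM _)) //.
have : `|x - y| < e / (`|M| + 1).
  near: y; apply: cvgr_dist_lt => //.
  by rewrite divr_gt0.
rewrite ltr_pdivlMr // distrC mulrC; apply: le_lt_trans.
by rewrite ler_wpM2r // (le_trans (ler_norm M)) // lerDl.
Unshelve. all: by end_near. Qed.

Lemma is_dualB f g : is_dual f -> is_dual g -> is_dual (fun x => f x - g x).
Proof.
move=> [fl fc] [gl gc]; split=> [a x y|x].
  by rewrite fl gl; ring.
by apply: cvgB; [exact: fc|exact: gc].
Qed.

Section one_functional.
Variables (f : E -> R) (fd : is_dual f).

Lemma dual0 : f 0 = 0.
Proof. by have := fd.1 1 0 0; rewrite scale1r addr0 mul1r; lra. Qed.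

Lemma dualD x y : f (x + y) = f x + f y.
Proof. by have := fd.1 1 x y; rewrite scale1r mul1r. Qed.

Lemma dualZ (a : R) x : f (a *: x) = a * f x.
Proof. by have := fd.1 a x 0; rewrite addr0 dual0 addr0. Qed.

Lemma dualN x : f (- x) = - f x.
Proof. by rewrite -scaleN1r dualZ mulN1r. Qed.

Lemma dualB x y : f (x - y) = f x - f y.
Proof. by rewrite dualD dualN. Qed.

Lemma dual_sum (y : nat -> E) m n :
  f (\sum_(m <= i < n) y i) = \sum_(m <= i < n) f (y i).
Proof. by apply: (big_morph f dualD dual0). Qed.

Lemma dual_bounded : exists2 M : R, 0 < M & forall x, `|f x| <= M * `|x|.
Proof.
have := fd.2 0; move=> /cvgrPdist_lt/(_ 1 ltr01)/nbhs_ballP[d /= d0 fd1].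
exists (2 / d); first by rewrite divr_gt0.
move=> x; have [->|x0] := eqVneq x 0; first by rewrite dual0 !normr0 mulr0.
have nx : 0 < `|x| by rewrite normr_gt0.
(* Rescaled to norm [d / 2], the vector falls in the ball where [|f| < 1]; this is the source of the
   bound [2 / d]. *)
have := fd1 ((d / 2 / `|x|) *: x).
rewrite -ball_normE /= dual0 !sub0r !normrN dualZ normrZ [`|_ * f x|]normrM.
have c0 : 0 < d / 2 / `|x| by rewrite !divr_gt0.
rewrite (gtr0_norm c0) divfK ?lt0r_neq0 // ltr_pdivrMr // ltr_pMr // ltr1n => /(_ isT)/ltW.
have -> : d / 2 / `|x| * `|f x| = `|f x| / (2 / d * `|x|).
  by field; rewrite !(lt0r_neq0 d0, lt0r_neq0 nx).
have k0 : 0 < 2 / d * `|x| by rewrite mulr_gt0 ?divr_gt0.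
by rewrite ler_pdivrMr // mul1r.
Qed.

End one_functional.

Lemma dual_norm_ub f x : is_dual f -> `|x| <= 1 -> f x <= dual_norm f.
Proof.
move=> fd x1; apply: (le_trans (ler_norm _)); rewrite /dual_norm.
have [M M0 fM] := dual_bounded fd.
apply: ub_le_sup; last by exists x.
by exists M => _ [y y1 <-]; apply: (le_trans (fM y)); rewrite ler_piMr // ltW.
Qed.

Lemma dual_norm_le f c : (forall x, `|x| <= 1 -> `|f x| <= c) -> dual_norm f <= c.
Proof.
move=> fc; apply: ge_sup; first by exists `|f 0|; exists 0; rewrite //= normr0 ler01.
by move=> _ [y y1 <-]; apply: fc.
Qed.

End functionals.

(** * Positive functionals, extension from the positive cone, restriction to ideals *)

Section positive_functionals.
Set Implicit Arguments. Unset Strict Implicit.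
Context {R : realType} {E : completeNormedModType R} (L : banach_lattice E).
Implicit Types (f g : E -> R) (x y u : E).

Local Notation "x '<=L' y" := (bl_le L x y) (at level 70, y at next level).
Local Notation inf := (bl_inf L).
Local Notation abs := (bl_abs L).
Local Notation pos := (bl_pos L).

Definition pos_dual f := is_dual f /\ dual_le L (fun=> 0) f.

Lemma pos_dual_mono f x y : pos_dual f -> x <=L y -> f x <= f y.
Proof.
by move=> [fd f0] /bl_subr_ge0/f0; rewrite dualB // subr_ge0.
Qed.

Lemma pos_dual_norm_le f x : pos_dual f -> `|f x| <= f (abs x).
Proof.
move=> fp; rewrite ler_norml lerNl -(dualN fp.1).
by rewrite !(pos_dual_mono fp) //; [exact: bl_sup_ubl|exact: bl_sup_ubr].
Qed.

Lemma pos_dual_norm_bound f c : pos_dual f ->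
  (forall x, 0 <=L x -> `|x| <= 1 -> f x <= c) -> dual_norm f <= c.
Proof.
move=> fp fc; apply: dual_norm_le => x x1; apply: (le_trans (pos_dual_norm_le x fp)).
by apply: fc; [exact: bl_abs_ge0|rewrite bl_norm_abs].
Qed.

(** Kantorovich extension: set [g x = p (x^+) - p (x^-)]. By additivity of [p], any decomposition of
    [x] as a difference of positive vectors gives the same value, which makes [g] linear. *)
Lemma dual_extension (p : E -> R) (M : R) : 0 <= M ->
  (forall x y, 0 <=L x -> 0 <=L y -> p (x + y) = p x + p y) ->
  (forall a x, 0 < a -> 0 <=L x -> p (a *: x) <= a * p x) ->
  (forall x, 0 <=L x -> `|p x| <= M * `|x|) ->
  exists2 g, is_dual g & forall x, 0 <=L x -> g x = p x.
Proof.
move=> M0 pD pZle pM.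
have p0 : p 0 = 0.
  by have := pD 0 0 (bl_refl L 0) (bl_refl L 0); rewrite addr0; lra.
(* The reverse inequality is the hypothesis applied to [a^-1] and [a *: x]. *)
have pZ a x : 0 <= a -> 0 <=L x -> p (a *: x) = a * p x.
  rewrite le_eqVlt => /orP[/eqP <- _|a0 x0]; first by rewrite scale0r mul0r.
  apply/eqP; rewrite eq_le pZle //= mulrC -ler_pdivlMr // mulrC.
  rewrite -{1}[x](scalerK (lt0r_neq0 a0)) pZle ?invr_gt0 //.
  by apply: bl_scale_ge0 => //; apply: ltW.
pose g x := p (pos x) - p (pos (- x)).
have gE x a b : 0 <=L a -> 0 <=L b -> x = a - b -> g x = p a - p b.
  move=> a0 b0 xab; have q0 y : 0 <=L pos y by exact: bl_pos_ge0.
  suff : p (pos x) + p b = p a + p (pos (- x)) by rewrite /g; lra.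
  rewrite -!pD //; congr p; apply/eqP; move: xab; rewrite {1}(bl_pos_subN L x) => /eqP.
  by rewrite subr_eq addrAC eq_sym subr_eq eq_sym.
exists g; last by move=> x x0; rewrite (gE _ x 0) ?p0 ?subr0 //; exact: bl_refl.
apply: (@is_dual_intro _ _ _ (M + M)) => [a x y|x].
  have q0 z : 0 <=L pos z by exact: bl_pos_ge0.
  have gD z t : g (z + t) = g z + g t.
    rewrite (gE (z + t) (pos z + pos t) (pos (- z) + pos (- t))); try exact: bl_addr_ge0.
      by rewrite !pD // /g; lra.
    by rewrite {1}(bl_pos_subN L z) {1}(bl_pos_subN L t) opprD addrACA.
  have gN z : g (- z) = - g z by rewrite /g opprK opprB.
  have gZ c z : 0 <= c -> g (c *: z) = c * g z.
    move=> c0; rewrite (gE _ (c *: pos z) (c *: pos (- z))); try exact: bl_scale_ge0.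
      by rewrite !pZ // -mulrBr.
    by rewrite -scalerBr -bl_pos_subN.
  rewrite gD; congr (_ + _); have [a0|a0] := leP 0 a; first exact: gZ.
  by rewrite -[a]opprK scaleNr gN gZ ?mulNr // oppr_ge0 ltW.
have b y : `|y| = `|x| -> `|p (pos y)| <= M * `|x|.
  move=> <-; apply: (le_trans (pM _ (bl_pos_ge0 L y))).
  by apply: ler_wpM2l => //; apply: bl_norm_pos.
by rewrite /g (le_trans (ler_normB _ _)) // mulrDl lerD // b // normrN.
Qed.


(** The positive elements of such a [D] form the positive part of an order ideal; [D] may also
    contain other vectors, as when it is the whole space. *)
Definition solid_cone (D : E -> Prop) :=
  [/\ D 0, forall x y, D x -> D y -> D (x + y),
      forall (a : R) x, 0 <= a -> D x -> D (a *: x) &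
      forall x y, D y -> 0 <=L x -> x <=L y -> D x].

(* [g x = sup {f y | y in D, 0 <= y <= x}] for [x >= 0]. *)
Definition restriction f (D : E -> Prop) g := is_dual g /\
  forall x c, 0 <=L x ->
    (g x <= c <-> forall y, D y -> 0 <=L y -> y <=L x -> f y <= c).

(** The supremum is additive by Riesz decomposition: [0 <= z <= x + y] splits as
    [inf z x + pos (z - x)], with pieces below [x] and [y] that stay in [D] by solidity. The
    converse inequality adds competitors for [x] and [y]. *)
Lemma restriction_exists f D : is_dual f -> solid_cone D -> exists g, restriction f D g.
Proof.
move=> fd [D0 DD DZ Ds]; have [M M0 fM] := dual_bounded fd.
pose S x := [set f y | y in [set y | [/\ D y, 0 <=L y & y <=L x]]].
have SM x : ubound (S x) (M * `|x|).
  move=> _ [y [_ y0 yx] <-]; apply: (le_trans (ler_norm _)); apply: (le_trans (fM _)).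
  by apply: ler_wpM2l; [exact: ltW|exact: (bl_norm_le y0 yx)].
have S0 x : 0 <=L x -> S x 0.
  by move=> x0; exists 0; [split => //; exact: bl_refl|exact: dual0].
have supS x c : 0 <=L x -> (sup (S x) <= c <-> forall y, D y -> 0 <=L y -> y <=L x -> f y <= c).
  move=> x0; split=> [h y Dy y0 yx|h].
    apply: le_trans h; apply: ub_le_sup; first by exists (M * `|x|); apply: SM.
    by exists y.
  apply: ge_sup; first by exists 0; apply: S0.
  by move=> _ [y [Dy y0 yx] <-]; apply: h.
have Sub x y : 0 <=L x -> D y -> 0 <=L y -> y <=L x -> f y <= sup (S x).
  by move=> x0; apply: (supS x _ x0).1.
have [|x y x0 y0|a x a0 x0|x x0|g gd gS] := @dual_extension (fun x => sup (S x)) M.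
- exact: ltW.
- have xy0 := bl_addr_ge0 x0 y0.
  apply/eqP; rewrite eq_le; apply/andP; split.
    apply/supS => // z Dz z0 zxy.
    rewrite (bl_inf_add_pos L z x) dualD // lerD //; apply: Sub => //.
    + by apply: (Ds _ _ Dz); [exact: bl_inf_ge0|exact: bl_infl].
    + exact: bl_inf_ge0.
    + exact: bl_infr.
    + apply: (Ds _ _ Dz); first exact: bl_pos_ge0.
      by apply: bl_pos_le => //; apply/bl_lerBlDr; apply: bl_ler_addl.
    + exact: bl_pos_ge0.
    + by apply: bl_pos_le => //; apply/bl_lerBlDr; rewrite addrC.
  rewrite -lerBrDr; apply/supS => // z Dz z0 zx; rewrite lerBrDr addrC -lerBrDr.
  apply/supS => // t Dt t0 ty; rewrite lerBrDr addrC -dualD //; apply: Sub => //.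
  + exact: DD.
  + exact: bl_addr_ge0.
  + exact: bl_leD.
- have a0' := ltW a0; apply/supS; first exact: bl_scale_ge0.
  have ai : 0 <= a^-1 by rewrite invr_ge0.
  move=> y Dy y0 yax; rewrite -[y](scalerKV (lt0r_neq0 a0)) dualZ // ler_pM2l //.
  apply: Sub => //; [exact: DZ|exact: bl_scale_ge0|].
  by rewrite -[x](scalerK (lt0r_neq0 a0)); apply: bl_scale.
- rewrite ger0_norm; first by apply: ge_sup; [exists 0; exact: S0|exact: SM].
  by apply: ub_le_sup; [exists (M * `|x|); exact: SM|exact: S0].
by exists g; split=> // x c x0; rewrite gS //; apply: supS.
Qed.

Lemma restriction_ub f D g x y : restriction f D g -> D y -> 0 <=L y -> y <=L x -> f y <= g x.
Proof.
move=> [_ gE] Dy y0 yx; have x0 := bl_trans y0 yx.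
exact: ((gE x (g x) x0).1 (lexx _) y).
Qed.

Lemma restriction_pos f D g : is_dual f -> solid_cone D -> restriction f D g -> pos_dual g.
Proof.
move=> fd [D0 _ _ _] fg; split; first exact: fg.1.
move=> x x0; rewrite -(dual0 fd).
by apply: (restriction_ub fg D0) => //; apply: bl_refl.
Qed.

Lemma restriction_le f D g : pos_dual f -> restriction f D g -> dual_le L g f.
Proof. by move=> fp [_ gE] x x0; apply/gE => // y _ _; apply: pos_dual_mono. Qed.

Lemma restriction_mono f D D' g g' : (forall x, D x -> D' x) ->
  restriction f D g -> restriction f D' g' -> dual_le L g g'.
Proof.
move=> DD' [_ gE] fg' x x0; apply/gE => // y Dy y0 yx.
by apply: (restriction_ub fg') => //; apply: DD'.
Qed.

(** Restricting to the whole space yields the positive part of [f]; it dominates [f] on the cone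
    because [x] competes in its own supremum. *)
Lemma dual_pos_decomposition f : is_dual f ->
  exists g h, [/\ pos_dual g, pos_dual h & forall x, f x = g x - h x].
Proof.
move=> fd; have sc : solid_cone (fun _ => True) by [].
have [g fg] := restriction_exists fd sc.
have gp := restriction_pos fd sc fg.
exists g, (fun x => g x - f x); split=> // [|x]; last by rewrite opprB addrC subrK.
split; first by apply: is_dualB => //; case: gp.
by move=> x x0; rewrite subr_ge0; apply: (restriction_ub fg) => //; apply: bl_refl.
Qed.

Lemma weakly_null_of_pos (x : nat -> E) :
  (forall f, pos_dual f -> f \o x @ \oo --> (0 : R)) -> weakly_null x.
Proof.
move=> xf f /dual_pos_decomposition[g [h [gp hp fE]]].
rewrite (_ : (fun n => f (x n)) = (fun n => g (x n) - h (x n))); last first.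
  by apply/funext => n; exact: fE.
by rewrite -[0]subr0; apply: cvgB; [exact: (xf g)|exact: (xf h)].
Qed.

End positive_functionals.

(** * Order continuity of the dual norm *)

Section dual_order_continuity.
Set Implicit Arguments. Unset Strict Implicit.
Context {R : realType} {E : completeNormedModType R} (L : banach_lattice E).
Implicit Types (f g : E -> R) (x y u : E).

Local Notation "x '<=L' y" := (bl_le L x y) (at level 70, y at next level).
Local Notation inf := (bl_inf L).
Local Notation pos := (bl_pos L).

(* The unit ball is almost order bounded for each seminorm [f(|x|)]. *)
Definition ball_almost_order_bounded := forall f (e : R), pos_dual L f -> 0 < e ->
  exists2 u, 0 <=L u & forall x, 0 <=L x -> `|x| <= 1 -> f (pos (x - u)) <= e.

Definition ideal_cone u y := 0 <=L y /\ exists2 k : R, 0 <= k & y <=L k *: u.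

Lemma ideal_cone_solid u : solid_cone L (ideal_cone u).
Proof.
split=> [|x y [x0 [k k0 xk]] [y0 [l l0 yl]]|a x a0 [x0 [k k0 xk]]|x y [y0 [k k0 yk]] x0 xy].
- by split; [exact: bl_refl|exists 0; rewrite ?scale0r //; exact: bl_refl].
- split; first exact: bl_addr_ge0.
  by exists (k + l); rewrite ?addr_ge0 // scalerDl; apply: bl_leD.
- split; first exact: bl_scale_ge0.
  by exists (a * k); rewrite ?mulr_ge0 // -scalerA; apply: bl_scale.
- by split=> //; exists k => //; apply: (bl_trans xy).
Qed.

Lemma expon2_gt0 n : 0 < 2 ^+ n :> R.
Proof. by rewrite exprn_gt0. Qed.

Lemma sum_expon2V_le m n : \sum_(m <= i < n) (2 ^+ i)^-1 <= 2 * (2 ^+ m)^-1 :> R.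
Proof.
(* Keeping the remainder [2 * 2^-n] turns the bound into one that induction on [n] preserves. *)
suff h : (m <= n)%N -> \sum_(m <= i < n) (2 ^+ i)^-1 <= 2 * (2 ^+ m)^-1 - 2 * (2 ^+ n)^-1 :> R.
  have p : 0 < (2 ^+ m)^-1 :> R by rewrite invr_gt0 expon2_gt0.
  have q : 0 < (2 ^+ n)^-1 :> R by rewrite invr_gt0 expon2_gt0.
  have [/h|nm] := leqP m n; first by lra.
  by rewrite big_geq ?(ltnW nm) //; lra.
elim: n => [|n IH]; first by rewrite leqn0 => /eqP->; rewrite big_geq // subrr.
rewrite leq_eqVlt => /orP[/eqP->|]; first by rewrite big_geq // subrr.
rewrite ltnS => mn; rewrite big_nat_recr //=; have := IH mn.
have -> : (2 ^+ n.+1)^-1 = 2^-1 * (2 ^+ n)^-1 :> R by rewrite exprS invfM.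
by lra.
Qed.

(** For nonnegative [w], the positive part of the ideal generated by the [w i] with [i >= n]. A
    single coefficient [k] suffices, as coefficients may be enlarged. *)
Definition tail_cone (w : nat -> E) n y := 0 <=L y /\
  exists2 k : R, 0 <= k & exists N, y <=L \sum_(n <= i < N) k *: w i.

Lemma tail_cone_solid w n : (forall i, 0 <=L w i) -> solid_cone L (tail_cone w n).
Proof.
move=> w0.
have sumD N M k : (n <= N)%N -> 0 <= k ->
    \sum_(n <= i < N) k *: w i <=L \sum_(n <= i < N + M) k *: w i.
  move=> nN k0; rewrite (@big_cat_nat _ _ _ N n (N + M)) ?leq_addr //=.
  by apply: bl_ler_addl; apply: bl_sum_ge0 => i; apply: bl_scale_ge0.
have sum_le N M k : (N <= M)%N -> 0 <= k ->
    \sum_(n <= i < N) k *: w i <=L \sum_(n <= i < M) k *: w i.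
  move=> NM k0; have [nN|Nn] := leqP n N; first by rewrite -(subnKC NM); apply: sumD.
  rewrite (@big_geq _ _ _ n N) ?(ltnW Nn) //.
  by apply: bl_sum_ge0 => i; apply: bl_scale_ge0.
split=> [|x y [x0 [k k0 [N xk]]] [y0 [l l0 [M yl]]]|a x a0 [x0 [k k0 [N xk]]]|x y [y0 [k k0 [N yk]]] x0 xy].
- split; first exact: bl_refl.
  by exists 0 => //; exists n; rewrite big_geq //; exact: bl_refl.
- split; first exact: bl_addr_ge0.
  exists (k + l); first by rewrite addr_ge0.
  exists (N + M)%N; under eq_bigr do rewrite scalerDl.
  rewrite big_split /=; apply: bl_leD.
    by apply: (bl_trans xk); apply: sum_le; rewrite ?leq_addr.
  by apply: (bl_trans yl); apply: sum_le; rewrite ?leq_addl.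
- split; first exact: bl_scale_ge0.
  exists (a * k); rewrite ?mulr_ge0 //; exists N.
  by under eq_bigr do rewrite -scalerA; rewrite -scaler_sumr; apply: bl_scale.
- by split=> //; exists k => //; exists N; apply: (bl_trans xy).
Qed.

Lemma tail_cone_le w m n y : (forall i, 0 <=L w i) -> (m <= n)%N ->
  tail_cone w n y -> tail_cone w m y.
Proof.
move=> w0 mn [y0 [k k0 [N yk]]]; split=> //; exists k => //; exists N.
apply: (bl_trans yk); have kw0 i : 0 <=L k *: w i by exact: bl_scale_ge0.
have [nN|/ltnW Nn] := leqP n N; last first.
  by rewrite big_geq //; apply: bl_sum_ge0.
by rewrite (@big_cat_nat _ _ _ n m N) //=; apply: bl_ler_addr; apply: bl_sum_ge0.
Qed.

Hypothesis oc : dual_order_continuous L.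

Lemma ideal_cone_restriction_approx f (e : R) : pos_dual L f -> 0 < e ->
  exists u h, [/\ 0 <=L u, restriction L f (ideal_cone u) h &
    dual_norm (fun x => f x - h x) < e].
Proof.
move=> fp e0.
have [p pE] := choice (fun u => restriction_exists fp.1 (ideal_cone_solid u)).
have scm u v x : u <=L v -> ideal_cone u x -> ideal_cone v x.
  move=> uv [x0 [k k0 xk]]; split=> //; exists k => //.
  by apply: (bl_trans xk); apply: bl_scale.
have [||||||||[u u0] uE] := oc (I := {u | 0 <=L u})
    (leI := fun i j => sval i <=L sval j) (f := fun i x => f x - p (sval i) x) _ _ _ _ _ _ _ _ e0.
- by exists (exist _ 0 (bl_refl L 0)).
- by move=> u; exact: bl_refl.
- by move=> u v w; exact: bl_trans.
- move=> [u u0] [v v0]; exists (exist _ (u + v) (bl_addr_ge0 u0 v0)) => /=.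
  by split; [exact: bl_ler_addl|exact: bl_ler_addr].
- by move=> u; apply: is_dualB; [case: fp|case: (pE (sval u))].
- move=> u v uv x x0; rewrite lerB //.
  by apply: (restriction_mono _ (pE _) (pE _)) => // y; exact: scm.
- by move=> u x x0; rewrite subr_ge0; apply: (restriction_le fp (pE _)).
(* The infimum is 0: at the point [x], the index [x] itself contributes at most 0, since [x] lies in
   the ideal it generates. *)
- move=> g gd gle x x0; apply: (le_trans (gle (exist _ x x0) x x0)) => /=.
  rewrite subr_le0; apply: (restriction_ub (pE x)) => //; last exact: bl_refl.
  by split=> //; exists 1; rewrite ?scale1r //; exact: bl_refl.
exists u, (p u); split=> //.
by have := uE (exist _ u u0) (bl_refl L u).
Qed.

Lemma ideal_cone_restriction_tail f u h (e : R) : pos_dual L f -> 0 <=L u ->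
  restriction L f (ideal_cone u) h -> 0 < e ->
  exists2 k : R, 0 <= k & forall x, 0 <=L x -> `|x| <= 1 -> h (pos (x - k *: u)) <= e.
Proof.
move=> fp u0 fh e0; apply: contrapT => hN.
have /choice[x xP] : forall n, exists x,
    [/\ 0 <=L x, `|x| <= 1 & e < h (pos (x - 2 ^+ n *: u))].
  move=> n; apply: contrapT => nx; apply: hN; exists (2 ^+ n); first exact: ltW (expon2_gt0 _).
  by move=> x x0 x1; rewrite leNgt; apply/negP => xe; apply: nx; exists x.
pose w n := pos (x n - 2 ^+ n *: u).
have x0 n : 0 <=L x n by have [] := xP n.
have w0 n : 0 <=L w n by exact: bl_pos_ge0.
have v0 n : 0 <=L 2 ^+ n *: u by apply: bl_scale_ge0 => //; exact: ltW (expon2_gt0 _).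
have hp : pos_dual L h := restriction_pos fp.1 (ideal_cone_solid u) fh.
have [M M0 hM] := dual_bounded hp.1.
have [p pE] := choice (fun n => restriction_exists hp.1 (tail_cone_solid n w0)).
have pp n : pos_dual L (p n) := restriction_pos hp.1 (tail_cone_solid n w0) (pE n).
(* On the ideal of [u] the restrictions decay like [2^-n]: a competitor lies below [k u] and below a
   sum of [l w_i], hence below the sum of their infima, a geometric tail in the [x_i]. *)
have small n (k : R) y : 0 <= k -> 0 <=L y -> y <=L k *: u ->
    p n y <= 2 * k * M * (2 ^+ n)^-1.
  move=> k0 y0 yk; apply/(pE n).2 => // z [_ [l l0 [N zl]]] z0 zy.
  have ku0 : 0 <=L k *: u by exact: bl_scale_ge0.
  have lw0 i : 0 <=L l *: w i by exact: bl_scale_ge0.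
  have {zl zy}zb : z <=L \sum_(n <= i < N) (k * (2 ^+ i)^-1) *: x i.
    apply: (bl_trans (y := inf (k *: u) (\sum_(n <= i < N) l *: w i))).
      by apply: bl_inf_greatest => //; apply: (bl_trans zy).
    apply: (bl_trans (bl_inf_sum n N ku0 lw0)).
    elim/big_ind2: _ => // [|a b c d|i _]; [exact: bl_refl|exact: bl_leD|].
    (* Writing [k u] as [k 2^-i] times [2^i u] matches the truncation level in [w i]. *)
    rewrite -{1}[u](scalerK (lt0r_neq0 (expon2_gt0 i))) scalerA.
    by apply: bl_infZ_pos_le => //; rewrite mulr_ge0 // invr_ge0 ltW // expon2_gt0.
  apply: (le_trans (pos_dual_mono hp zb)); rewrite dual_sum ?hp.1 //; last by case: hp.
  apply: (@le_trans _ _ (k * M * \sum_(n <= i < N) (2 ^+ i)^-1)).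
    rewrite mulr_sumr; apply: ler_sum => i _; rewrite dualZ; last by case: hp.
    rewrite mulrAC; apply: ler_wpM2r; first by rewrite invr_ge0 ltW // expon2_gt0.
    apply: ler_wpM2l => //; apply: (le_trans (ler_norm _)); apply: (le_trans (hM _)).
    by rewrite ler_piMr ?(ltW M0) //; have [] := xP i.
  rewrite (_ : 2 * k * M * _ = k * M * (2 * (2 ^+ n)^-1)); last by ring.
  by apply: ler_wpM2l; [rewrite mulr_ge0 // ltW|exact: sum_expon2V_le].
have [||||||||n nE] := oc (I := nat) (leI := leq) (f := p) _ _ _ _ _ _ _ _ e0.
- by exists 0%N.
- by [].
- by move=> i j k; apply: leq_trans.
- by move=> i j; exists (i + j)%N; rewrite leq_addr leq_addl.
- by move=> i; case: (pp i).
- move=> i j ij; apply: (restriction_mono _ (pE j) (pE i)) => y.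
  exact: tail_cone_le.
- by move=> i; case: (pp i).
- move=> g gd gle z z0; apply/ler_addgt0Pr => d d0; rewrite add0r.
  have d2 : 0 < d / 2 by rewrite divr_gt0.
  (* Choose [y] in the ideal of [u] almost attaining [h z]. Then [g y <= p n y] is small for large
     [n], and [g (z - y) <= p n (z - y) <= h (z - y) < d / 2]. *)
  have [y [[y0 [k k0 yk]] yz hy]] : exists y, [/\ ideal_cone u y, y <=L z & h z - d / 2 < f y].
    apply: contrapT => ny; have : h z <= h z - d / 2.
      apply/fh.2 => // y Dy y0 yz; rewrite leNgt; apply/negP => fy; apply: ny.
      by exists y.
    by lra.
  have zy0 : 0 <=L z - y by apply/bl_subr_ge0.
  have fhy : f y <= h y.
    by apply: (restriction_ub fh) => //; [split=> //; exists k|exact: bl_refl].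
  have [n nd] : exists n, 2 * k * M * (2 ^+ n)^-1 <= d / 2.
    exists (Num.bound (2 * k * M / (d / 2))).
    rewrite ler_pdivrMr ?expon2_gt0 // [leRHS]mulrC -ler_pdivrMr // ltW //.
    exact: upper_nthrootP.
  have := small n k y k0 y0 yk; have := gle n y y0; have := gle n _ zy0.
  have := restriction_le hp (pE n) zy0.
  by rewrite !dualB //; [lra|case: hp|case: (pp n)].
(* Contradiction: [w n] lies in its own tail cone and below [x n], so [p n (x n) >= h (w n) > e],
   although [x n] is in the unit ball. *)
have [xn0 xn1 xne] := xP n; have := nE n (leqnn _); apply/negP; rewrite -leNgt.
apply: (le_trans _ (dual_norm_ub (pp n).1 xn1)); apply: (le_trans (ltW xne)).
apply: (restriction_ub (pE n)); [|exact: w0|].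
  split; first exact: w0.
  by exists 1 => //; exists n.+1; rewrite big_nat1 scale1r; exact: bl_refl.
by apply: bl_pos_le => //; apply/bl_lerBlDr; apply: bl_ler_addl.
Qed.

(** Each of the two reductions costs [e / 2]: the excess over [k u] stays in the unit ball, so
    replacing [f] by [h] there costs at most the norm of [f - h]. *)
Lemma dual_oc_ball_almost_order_bounded : ball_almost_order_bounded.
Proof.
move=> f e fp e0; have e2 : 0 < e / 2 by rewrite divr_gt0.
have [u [h [u0 fh fhe]]] := ideal_cone_restriction_approx fp e2.
have [k k0 hk] := ideal_cone_restriction_tail fp u0 fh e2.
have ku0 : 0 <=L k *: u by exact: bl_scale_ge0.
exists (k *: u) => // x x0 x1.
have px : `|pos (x - k *: u)| <= 1.
  apply: le_trans x1; apply: bl_norm_le; first exact: bl_pos_ge0.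
  by apply: bl_pos_le => //; apply/bl_lerBlDr; apply: bl_ler_addl.
have := dual_norm_ub (is_dualB fp.1 fh.1) px; have := hk x x0 x1.
by lra.
Qed.

End dual_order_continuity.

(** * Consequences of almost order boundedness of the unit ball, and of its failure *)

Section almost_order_boundedness.
Set Implicit Arguments. Unset Strict Implicit.
Context {R : realType} {E : completeNormedModType R} (L : banach_lattice E).
Implicit Types (f g : E -> R) (x y u : E).

Local Notation "x '<=L' y" := (bl_le L x y) (at level 70, y at next level).
Local Notation inf := (bl_inf L).
Local Notation abs := (bl_abs L).
Local Notation pos := (bl_pos L).

(** Directedness makes the pointwise infimum additive on the cone, so it extends to a functional
    below the whole net, which is then at most 0. *)
Lemma decreasing_net_pointwise (I : Type) (leI : I -> I -> Prop) (f : I -> E -> R) :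
  (exists i : I, True) ->
  (forall i j, exists k, leI i k /\ leI j k) ->
  (forall i, pos_dual L (f i)) ->
  (forall i j, leI i j -> dual_le L (f j) (f i)) ->
  (forall g, is_dual g -> (forall i, dual_le L g (f i)) -> dual_le L g (fun _ => 0)) ->
  forall x (e : R), 0 <=L x -> 0 < e -> exists i, f i x < e.
Proof.
move=> [i0 _] Idir fp fmono finf.
pose p x := reals.inf (range (f ^~ x)).
have lb x : 0 <=L x -> has_lbound (range (f ^~ x)).
  by move=> x0; exists 0 => _ [i _ <-]; apply: (fp i).2.
have p_le i x : 0 <=L x -> p x <= f i x by move=> x0; apply: ge_inf; [exact: lb|exists i].
have le_p x c : (forall i, c <= f i x) -> c <= p x.
  by move=> cf; apply: lb_le_inf; [exists (f i0 x); exists i0|move=> _ [i _ <-]].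
have [M M0 fM] := dual_bounded (fp i0).1.
have [|x y x0 y0|a x a0 x0|x x0|g gd gp] := @dual_extension _ _ L p M.
- exact: ltW.
- have xy0 := bl_addr_ge0 x0 y0; apply/eqP; rewrite eq_le; apply/andP; split.
    rewrite -lerBlDr; apply: (le_p) => i; rewrite lerBlDr [leRHS]addrC -lerBlDr.
    apply: le_p => j; rewrite lerBlDr [leRHS]addrC; have [k [ik jk]] := Idir i j.
    apply: (le_trans (p_le k _ xy0)); rewrite (dualD (fp k).1).
    by apply: lerD; apply: fmono.
  by apply: le_p => i; rewrite (dualD (fp i).1) lerD // p_le.
- rewrite mulrC -ler_pdivrMr //; apply: le_p => i; rewrite ler_pdivrMr // mulrC.
  by rewrite -(dualZ (fp i).1); apply: p_le; apply: bl_scale_ge0 => //; apply: ltW.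
- rewrite ger0_norm; last by apply: le_p => i; apply: (fp i).2.
  by apply: (le_trans (p_le i0 _ x0)); apply: (le_trans (ler_norm _)).
move=> x e x0 e0; apply: contrapT => nf.
have : g x <= 0.
  by apply: finf => // i y y0; rewrite gp //; apply: p_le.
rewrite gp // leNgt => /negP; apply; apply: (lt_le_trans e0); apply: le_p => i.
by rewrite leNgt; apply/negP => fe; apply: nf; exists i.
Qed.

(** For late [i], the truncated part of [x] costs at most [f i1 u] and the excess at most its value
    under [f i0]; both are within [e / 4], uniformly on the ball. *)
Lemma ball_almost_order_bounded_dual_oc :
  ball_almost_order_bounded L -> dual_order_continuous L.
Proof.
move=> B I leI f I0 Irefl Itrans Idir fd fmono f0 finf e e0.
have fp i : pos_dual L (f i) by [].
have e4 : 0 < e / 4 by rewrite divr_gt0.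
have [i0 _] := I0.
have [u u0 fu] := B (f i0) (e / 4) (fp i0) e4.
have [i1 fi1] := decreasing_net_pointwise I0 Idir fp fmono finf u0 e4.
have [k [i0k i1k]] := Idir i0 i1; exists k => i ki.
apply: (@le_lt_trans _ _ (e / 2)); last by lra.
apply: (pos_dual_norm_bound (fp i)) => x x0 x1.
rewrite (bl_inf_add_pos L x u) (dualD (fd i)).
have := pos_dual_mono (fp i) (bl_infr L x u).
have := fmono _ _ (Itrans _ _ _ i1k ki) u u0.
have := fmono _ _ (Itrans _ _ _ i0k ki) _ (bl_pos_ge0 L (x - u)).
have := fu x x0 x1; by lra.
Qed.

(** After scaling by [N] into the unit ball, the excess of [|x n|] over [N u] is uniformly small
    under [f], and the truncation at [N u] tends to 0 by uaw-nullity. *)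
Lemma uaw_null_weakly_null (x : nat -> E) (M : R) : ball_almost_order_bounded L ->
  (forall n, `|x n| <= M) -> uaw_null L x -> weakly_null x.
Proof.
move=> B xM xuaw; apply: (weakly_null_of_pos (L := L)) => f fp.
pose N := `|M| + 1; have N0 : 0 < N by rewrite ltr_wpDl.
have xN n : `|x n| <= N.
  by apply: (le_trans (xM n)); apply: (le_trans (ler_norm M)); rewrite lerDl.
apply/cvgrPdist_lt => e e0.
have eN : 0 < e / 2 / N by rewrite !divr_gt0.
have [u u0 fu] := B f (e / 2 / N) fp eN.
have Nu0 : 0 <=L N *: u by apply: bl_scale_ge0 => //; exact: ltW.
have := xuaw (N *: u) Nu0 f fp.1.
move=> /cvgrPdist_lt/(_ (e / 2)); rewrite divr_gt0 // => /(_ isT).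
apply: filterS => n /=; rewrite !sub0r !normrN => fn.
apply: (le_lt_trans (pos_dual_norm_le (x n) fp)).
have Ni : 0 < N^-1 by rewrite invr_gt0.
set y := N^-1 *: abs (x n).
have y0 : 0 <=L y by apply: bl_scale_ge0; [exact: ltW|exact: bl_abs_ge0].
have y1 : `|y| <= 1.
  by rewrite normrZ gtr0_norm // bl_norm_abs mulrC ler_pdivrMr // mul1r.
have -> : abs (x n) = N *: y by rewrite scalerKV // lt0r_neq0.
rewrite (dualZ fp.1) (bl_inf_add_pos L y u) (dualD fp.1) mulrDr.
have h1 : N * f (pos (y - u)) <= e / 2.
  by rewrite mulrC -ler_pdivlMr //; apply: fu.
have h2 : N * f (inf y u) <= f (inf (abs (x n)) (N *: u)).
  rewrite mulrC -ler_pdivlMr // mulrC -(dualZ fp.1); apply: (pos_dual_mono fp).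
  rewrite -{1}[u](scalerK (lt0r_neq0 N0)).
  exact: bl_infZ_le.
have := ler_norm (f (inf (abs (x n)) (N *: u))).
by lra.
Qed.

Lemma not_ball_almost_order_bounded_seq : ~ ball_almost_order_bounded L ->
  exists f (e : R) (z : nat -> E), [/\ pos_dual L f, 0 < e, uaw_null L z,
    (forall n, `|z n| <= 1) & (forall n, e < f (z n))].
Proof.
move=> nB.
have [f [e [fp e0 nfe]]] : exists f (e : R), [/\ pos_dual L f, 0 < e &
    ~ exists2 u, 0 <=L u & forall x, 0 <=L x -> `|x| <= 1 -> f (pos (x - u)) <= e].
  apply: contrapT => h; apply: nB => f e fp e0; apply: contrapT => nf.
  by apply: h; exists f, e.
have /choice[X XP] : forall u, exists x, 0 <=L u ->
    [/\ 0 <=L x, `|x| <= 1 & e < f (pos (x - u))].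
  (* For [u] outside the cone the requirement is vacuous and 0 is a dummy value. *)
  move=> u; have [u0|nu0] := pselect (0 <=L u); last by exists 0.
  apply: contrapT => nx; apply: nfe; exists u => // x x0 x1.
  by rewrite leNgt; apply/negP => xe; apply: nx; exists x.
(* [s n] is the sum of the first [n] chosen vectors, and the next one is chosen against
   [2^n s n]. *)
pose s := fix s n := if n is m.+1 then s m + X (2 ^+ m *: s m) else 0.
have p2 n : 0 < 2 ^+ n :> R by rewrite exprn_gt0.
have s0 n : 0 <=L s n.
  elim: n => [|n IH] /=; first exact: bl_refl.
  have [] := XP (2 ^+ n *: s n); last by move=> ? _ _; exact: bl_addr_ge0.
  by apply: bl_scale_ge0 => //; exact: ltW.
pose x n := X (2 ^+ n *: s n).
have xP n : [/\ 0 <=L x n, `|x n| <= 1 & e < f (pos (x n - 2 ^+ n *: s n))].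
  by apply: XP; apply: bl_scale_ge0 => //; exact: ltW.
have x0 n : 0 <=L x n by have [] := xP n.
pose z n := pos (x n - 2 ^+ n *: s n).
have z0 n : 0 <=L z n by exact: bl_pos_ge0.
have zx n : z n <=L x n.
  apply: bl_pos_le => //; apply/bl_lerBlDr; apply: bl_ler_addl.
  by apply: bl_scale_ge0 => //; exact: ltW.
exists f, e, z; split=> // [u u0|n|n]; last 2 first.
- by have [_ x1 _] := xP n; apply: le_trans x1; apply: bl_norm_le.
- by have [] := xP n.
(* The first bound is carried along because absorbing the next term in the second one uses that the
   partial sum lies below [s n]. *)
have S n : \sum_(0 <= i < n) inf (z i) u <=L s n /\
    \sum_(0 <= i < n) inf (z i) u <=L u + \sum_(0 <= i < n) (2 ^+ i)^-1 *: x i.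
  elim: n => [|n [IHs IHp]].
    by rewrite !big_geq // addr0; split => //; exact: bl_refl.
  rewrite !big_nat_recr //=; split.
    by apply: bl_leD => //; apply: (bl_trans (bl_infl _ _ _)).
  rewrite addrA; apply: (bl_add_inf_pos_le (a := s n)) => //.
  apply: bl_ler_addl; apply: bl_sum_ge0 => i.
  by apply: bl_scale_ge0 => //; rewrite invr_ge0 ltW.
apply: (weakly_null_of_pos (L := L)) => g gp.
have [M M0 gM] := dual_bounded gp.1.
pose v n := g (inf (z n) u).
have v0 n : 0 <= v n by apply: gp.2; exact: bl_inf_ge0.
have vsum n : \sum_(0 <= i < n) v i <= g u + M * (2 * (2 ^+ 0)^-1).
  rewrite -(dual_sum gp.1); apply: (le_trans (pos_dual_mono gp (S n).2)).
  rewrite (dualD gp.1) lerD2l (dual_sum gp.1).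
  apply: (@le_trans _ _ (M * \sum_(0 <= i < n) (2 ^+ i)^-1)); last first.
    by apply: ler_wpM2l; [exact: ltW|exact: sum_expon2V_le].
  rewrite mulr_sumr; apply: ler_sum => i _; rewrite (dualZ gp.1) mulrC.
  apply: ler_wpM2r; first by rewrite invr_ge0 ltW.
  apply: (le_trans (ler_norm _)); apply: (le_trans (gM _)).
  by rewrite ler_piMr ?(ltW M0) //; have [] := xP i.
(* The nonnegative series has bounded partial sums, so it converges and its terms tend to 0. *)
have vcvg : series v @ \oo --> sup (range (series v)).
  apply: nondecreasing_cvgn; first exact: nondecreasing_series.
  by exists (g u + M * (2 * (2 ^+ 0)^-1)) => _ [n _ <-]; rewrite /series /=.
rewrite (_ : _ \o _ = v); first exact: cvg_series_cvg_0 (cvgP _ vcvg).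
by apply/funext => n; rewrite /= bl_abs_id.
Qed.

End almost_order_boundedness.

(** * Hahn-Banach separation *)

Section hahn_banach.
Set Implicit Arguments. Unset Strict Implicit.
Context {R : realType} {V : lmodType R}.
Implicit Types (p q : V -> R) (x y : V).

Definition sublinear q := (forall x y, q (x + y) <= q x + q y) /\
  (forall (a : R) x, 0 < a -> q (a *: x) <= a * q x).

Lemma sublinear0 q : sublinear q -> q 0 = 0.
Proof.
move=> [_ qZ].
have h2 : q 0 <= 2 * q 0 by rewrite -{1}(scaler0 V 2) qZ.
have h : q 0 <= 2^-1 * q 0 by rewrite -{1}(scaler0 V 2^-1) qZ // invr_gt0.
by lra.
Qed.

Lemma sublinearZ q (a : R) x : sublinear q -> 0 <= a -> q (a *: x) = a * q x.
Proof.
move=> sq; rewrite le_eqVlt => /orP[/eqP <-|a0].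
  by rewrite scale0r mul0r sublinear0.
apply/eqP; rewrite eq_le sq.2 //= mulrC -ler_pdivlMr // mulrC.
by rewrite -{1}[x](scalerK (lt0r_neq0 a0)) sq.2 ?invr_gt0.
Qed.

Lemma sublinear_opp_ge q x : sublinear q -> - q (- x) <= q x.
Proof. by move=> sq; have := sq.1 x (- x); rewrite subrr sublinear0 //; lra. Qed.

(** Take [q' x] as the infimum over [t >= 0] of [q (x + t z) - t q z], bounded below by [- q (- x)].
    The choice [t = 0] gives [q' <= q], and [t = 1] gives the value at [- z]. *)
Lemma sublinear_tilt q z : sublinear q ->
  exists q', [/\ sublinear q', forall x, q' x <= q x & q' (- z) <= - q z].
Proof.
move=> sq; pose S x := [set q (x + t *: z) - t * q z | t in [set t : R | 0 <= t]].
have lb x : has_lbound (S x).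
  exists (- q (- x)) => _ [t /= t0 <-]; rewrite -sublinearZ //.
  by have := sq.1 (x + t *: z) (- x); rewrite addrAC subrr add0r; lra.
have S_le x t : 0 <= t -> inf (S x) <= q (x + t *: z) - t * q z.
  by move=> t0; apply: ge_inf => //; exists t.
have le_S x c : (forall t, 0 <= t -> c <= q (x + t *: z) - t * q z) -> c <= inf (S x).
  move=> h; apply: lb_le_inf; last by move=> _ [t t0 <-]; apply: h.
  by exists (q (x + 0 *: z) - 0 * q z); exists 0 => //=.
exists (fun x => inf (S x)); split; first split.
- move=> x y; rewrite -lerBlDr; apply: (le_S) => s s0; rewrite lerBlDr [leRHS]addrC -lerBlDr.
  apply: (le_S) => t t0; rewrite lerBlDr.
  apply: (le_trans (S_le _ (s + t) _)); first by rewrite addr_ge0.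
  have := sq.1 (x + s *: z) (y + t *: z).
  by rewrite addrACA -scalerDl; lra.
- move=> a x a0; rewrite mulrC -ler_pdivrMr //; apply: (le_S) => t t0.
  rewrite ler_pdivrMr //; apply: (le_trans (S_le _ (a * t) _)).
    by rewrite mulr_ge0 // ltW.
  rewrite -scalerA -scalerDr sublinearZ //; last exact: ltW.
  by lra.
- by move=> x; apply: (le_trans (S_le _ 0 _)) => //; rewrite scale0r addr0 mul0r subr0.
- apply: (le_trans (S_le _ 1 _)) => //.
  by rewrite scale1r addNr sublinear0 // mul1r sub0r.
Qed.

(* A minimal sublinear functional is odd, as tilting cannot decrease it,
   hence linear. *)
Lemma linear_below_sublinear p : sublinear p ->
  exists2 f : V -> R, (forall (a : R) x y, f (a *: x + y) = a * f x + f y) &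
    forall x, f x <= p x.
Proof.
move=> sp.
pose T := {q | sublinear q /\ forall x, q x <= p x}.
(* The order is reversed, so that a maximal element is a minimal sublinear functional; chains are
   bounded by pointwise infima, the empty chain by [p]. *)
pose below (s t : T) := `[< forall x, sval t x <= sval s x >].
have [||[s sP] [t tP] /asboolP/= st /asboolP/= ts|A tA|[q [sq qp]] qmin] := @Zorn T below.
- by move=> s; apply/asboolP => x.
- move=> t s u /asboolP st /asboolP tu; apply/asboolP => x.
  exact: (le_trans (tu x)).
- apply: eq_exist; apply/funext => x; apply/eqP.
  by rewrite eq_le st ts.
- have [[s0 As0]|A0] := pselect (exists s, A s); last first.
    by exists (exist _ p (conj sp (fun x => lexx _))) => s As; case: A0; exists s.
  pose S x := [set sval s x | s in A].
  have lb x : has_lbound (S x).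
    exists (- p (- x)) => _ [[s [ss sp']] _ <-] /=.
    by apply: le_trans (sublinear_opp_ge x ss); rewrite lerN2.
  have S_le x s : A s -> inf (S x) <= sval s x.
    by move=> As; apply: ge_inf => //; exists s.
  have le_S x c : (forall s, A s -> c <= sval s x) -> c <= inf (S x).
    move=> h; apply: lb_le_inf; last by move=> _ [s As <-]; apply: h.
    by exists (sval s0 x); exists s0.
  have sS : sublinear (fun x => inf (S x)).
    split=> [x y|a x a0].
      rewrite -lerBlDr; apply: (le_S) => s As; rewrite lerBlDr [leRHS]addrC -lerBlDr.
      apply: (le_S) => t At; rewrite lerBlDr.
      (* The smaller of the two chain members bounds the infimum at [x + y]. *)
      have [/asboolP h|/asboolP h] := tA s t As At.
        apply: (le_trans (S_le _ t At)); apply: (le_trans ((proj1 (svalP t)).1 _ _)).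
        by rewrite addrC lerD2l.
      apply: (le_trans (S_le _ s As)); apply: (le_trans ((proj1 (svalP s)).1 _ _)).
      by rewrite addrC lerD2r.
    rewrite mulrC -ler_pdivrMr //; apply: (le_S) => s As; rewrite ler_pdivrMr // mulrC.
    by apply: (le_trans (S_le _ s As)); apply: (proj1 (svalP s)).2.
  have Sp x : inf (S x) <= p x.
    by apply: (le_trans (S_le _ s0 As0)); apply: (svalP s0).2.
  exists (exist _ (fun x => inf (S x)) (conj sS Sp)) => s As; apply/asboolP => x /=.
  exact: S_le.
have qN x : q (- x) = - q x.
  have [q' [sq' q'q q'x]] := sublinear_tilt x sq.
  have q'p y : q' y <= p y := le_trans (q'q y) (qp y).
  have := qmin (exist _ q' (conj sq' q'p)) _; move/(_ (asboolT q'q)).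
  move=> /(congr1 sval)/= q'E; apply/eqP; rewrite eq_le -{1}q'E q'x /=.
  by have := sublinear_opp_ge x sq; lra.
exists q => // a x y.
have qD u v : q (u + v) = q u + q v.
  apply/eqP; rewrite eq_le sq.1 /= -lerN2 opprD -!qN opprD; exact: sq.1.
rewrite qD; congr (_ + _); have [a0|a0] := leP 0 a; first exact: sublinearZ.
by rewrite -[a]opprK scaleNr qN sublinearZ ?mulNr // oppr_ge0 ltW.
Qed.

End hahn_banach.

(** Tilting the norm along [y] before taking a linear minorant forces [f (- y) <= - |y| < 0]. *)
Lemma dual_separates (R : realType) (F : completeNormedModType R) (y : F) : y != 0 ->
  exists2 g : F -> R, is_dual g & g y != 0.
Proof.
move=> y0.
have sn : sublinear (fun x : F => `|x|).
  by split=> [x z|a x a0]; [exact: ler_normD|rewrite normrZ gtr0_norm].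
have [p [sp pn py]] := sublinear_tilt y sn.
have [f flin fp] := linear_below_sublinear sp.
have f0 : f 0 = 0 by have := flin 1 0 0; rewrite scale1r addr0; lra.
have fN x : f (- x) = - f x by have := flin (- 1) x 0; rewrite scaleN1r addr0 f0; lra.
exists f; last first.
  rewrite -oppr_eq0 -fN lt_eqF // (le_lt_trans (fp _)) // (le_lt_trans py) //.
  by rewrite oppr_lt0 normr_gt0.
apply: (is_dual_intro (M := 1)) => // x; rewrite mul1r ler_norml.
rewrite (le_trans (fp x) (pn x)) andbT lerNl -fN.
by rewrite (le_trans (fp _)) // (le_trans (pn _)) // normrN.
Qed.

(** * Operators *)

Section operators.
Set Implicit Arguments. Unset Strict Implicit.

(** If [F] missed a neighbourhood of [x], its trace on the complement of the interior would still
    cluster in [A]; that point also clusters [F], hence equals [x], which is absurd. *)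
Lemma compact_cluster_cvg (T : topologicalType) (A : set T) (F : set_system T) (x : T) :
  ProperFilter F -> compact A -> F A -> cluster F `<=` [set x] -> F --> x.
Proof.
move=> PF cA FA clF U nU; rewrite nbhs_simpl; apply: contrapT => nFU.
pose G := within (~` U^°) F.
have PG : ProperFilter G.
  apply: Build_ProperFilter_ex => B GB.
  have {}GB : F [set z | ~ U^° z -> B z] by [].
  apply/set0P/eqP => B0; apply: nFU; apply: filterS GB => z; rewrite B0 => h.
  by apply: contrapT => nUz; apply: h => /interior_subset.
have GA : G A by change (F [set z | ~ U^° z -> A z]); apply: filterS FA => z Az _.
have [q [_ clq]] := cA G PG GA.
have qx : q = x by apply: clF; apply: cvg_cluster clq; apply: cvg_within.
have GU : G (~` U^°) by exact: withinT.
have Uq : nbhs q U^° by rewrite qx; apply: nbhs_interior.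
by have [z []] := clq _ _ GU Uq.
Qed.

Context {R : realType} {E F : completeNormedModType R}.

Lemma weakly_nullZ (a : R) (x : nat -> E) :
  weakly_null x -> weakly_null (fun n => a *: x n).
Proof.
move=> xw f fd; rewrite (_ : (fun n => _) = (fun n => a * f (x n))).
  by rewrite -[0](mulr0 a); apply: cvgMr; exact: xw.
by apply/funext => n; rewrite dualZ.
Qed.

Lemma dual_comp (T : {linear E -> F}) (g : F -> R) :
  continuous T -> is_dual g -> is_dual (g \o T).
Proof.
move=> Tc [gl gc]; split=> [a x y|x]; first by rewrite /= linearP gl.
by apply: continuous_comp; [exact: Tc|exact: gc].
Qed.

(** The rescaled images stay in a compact set. Every functional [g] vanishes at their cluster points
    because [g \o T] is a functional on [E], so 0 is the only cluster point. *)
Lemma compact_op_weakly_null (T : {linear E -> F}) (x : nat -> E) (M : R) :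
  continuous T -> compact_op T -> (forall n, `|x n| <= M) -> weakly_null x ->
  T \o x @ \oo --> (0 : F).
Proof.
move=> Tc Tk xM xw.
pose N := `|M| + 1; have N0 : 0 < N by rewrite ltr_wpDl.
pose y n := N^-1 *: x n.
have yw : weakly_null y by apply: weakly_nullZ.
have y1 n : `|y n| <= 1.
  rewrite normrZ gtr0_norm ?invr_gt0 // mulrC ler_pdivrMr // mul1r.
  by apply: (le_trans (xM n)); apply: (le_trans (ler_norm M)); rewrite lerDl.
have Ty n : closure (T @` [set x : E | `|x| <= 1]) (T (y n)).
  by apply: subset_closure; exists (y n) => //; exact: y1.
have Ty0 : T \o y @ \oo --> (0 : F).
  apply: (compact_cluster_cvg _ Tk); first by exists 0%N => // n _; exact: Ty.
  move=> q clq; apply: contrapT => /eqP/dual_separates[g gd gq].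
  have gq2 : 0 < `|g q| / 2 by rewrite divr_gt0 ?normr_gt0.
  have := yw _ (dual_comp Tc gd); move=> /cvgrPdist_lt/(_ _ gq2) h1.
  have := gd.2 q; move=> /cvgrPdist_lt/(_ _ gq2) h2.
  have [z [/= z1 z2]] := clq [set z | `|0 - g z| < `|g q| / 2] _ h1 h2.
  have := ler_normD (g q - g z) (g z); rewrite subrK; move: z1; rewrite sub0r normrN.
  by move: z2 => /=; lra.
rewrite (_ : T \o x = (fun n => N *: (T \o y) n)); last first.
  by apply/funext => n; rewrite /= /y linearZ scalerKV // lt0r_neq0.
by rewrite -[0 : F](scaler0 _ N); apply: cvgZr.
Qed.

(** * Rank one operators *)

Section rank_one.
Variables (f : E -> R) (fd : is_dual f) (y : F).

Lemma rank_one_linear : linear (fun x => f x *: y).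
Proof. by move=> a u v; rewrite fd.1 scalerDl scalerA. Qed.

Definition rank_one : {linear E -> F} := HB.pack (fun x => f x *: y)
  (GRing.isLinear.Build R E F *:%R (fun x => f x *: y) rank_one_linear).

Lemma rank_one_continuous : continuous rank_one.
Proof. by move=> x; apply: cvgZl; apply: fd.2. Qed.

Lemma rank_one_dunford_pettis : dunford_pettis rank_one.
Proof.
by move=> x xw; rewrite -[0](scale0r y); apply: cvgZl; apply: xw.
Qed.

(** The image of the ball lies in the segment of multiples [t y] with [|t| <= M], which is
    compact. *)
Lemma rank_one_compact : compact_op rank_one.
Proof.
have [M M0 fM] := dual_bounded fd.
have Kc : compact ((fun t : R => t *: y) @` `[- M, M]).
  apply: continuous_compact; last exact: segment_compact.
  by apply: continuous_subspaceT => t; apply: cvgZl; exact: cvg_id.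
have /closure_id Kcl := compact_closed (@norm_hausdorff _ F) Kc.
apply: (subclosed_compact _ Kc); first exact: closed_closure.
rewrite Kcl; apply: closureS => _ [x /= x1 <-].
exists (f x) => //=; rewrite in_itv /= -ler_norml (le_trans (fM x)) //.
by rewrite ler_piMr // ltW.
Qed.

End rank_one.
End operators.

Theorem theorem3p1 (R : realType) (E F : completeNormedModType R)
    (LE : banach_lattice E) (LF : banach_lattice F) :
  let P1 := forall T : {linear E -> F}, continuous T -> positive_op LE LF T ->
              dunford_pettis T -> uaw_dunford_pettis LE T in
  let P2 := forall T : {linear E -> F}, continuous T -> positive_op LE LF T ->
              compact_op T -> uaw_dunford_pettis LE T in
  let P3 := dual_order_continuous LE \/ (forall y : F, y = 0) in
  (P1 <-> P2) /\ (P2 <-> P3).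
Proof.
move=> P1 P2 P3.
(* Positive rank one operators are both compact and Dunford-Pettis, so this one implication serves
   (1) and (2). *)
have rank_oneP3 :
    (forall f (y : F) (fd : is_dual f), pos_dual LE f -> bl_le LF 0 y ->
      uaw_dunford_pettis LE (rank_one fd y)) -> P3.
  move=> h; have [F0|/existsNP[y /eqP y0]] := pselect (forall y : F, y = 0); [by right|left].
  apply: ball_almost_order_bounded_dual_oc.
  apply: contrapT => /not_ball_almost_order_bounded_seq[f [e [z [fp e0 zuaw z1 fz]]]].
  (* Passing from [y] to its modulus gives a positive vector that is still nonzero. *)
  have ny : 0 < `|bl_abs LF y| by rewrite bl_norm_abs normr_gt0.
  have := h f _ fp.1 fp (bl_abs_ge0 LF y) z (ex_intro _ 1 z1) zuaw.
  move=> /cvgrPdist_lt/(_ _ (mulr_gt0 e0 ny))[n _ /(_ n (leqnn n))] /=.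
  rewrite sub0r normrN normr_id normrZ ltr_pM2r // ltNge => /negP; apply.
  exact: le_trans (ltW (fz n)) (ler_norm _).
have rank_one_pos f (y : F) (fd : is_dual f) : pos_dual LE f -> bl_le LF 0 y ->
    positive_op LE LF (rank_one fd y).
  by move=> fp y0 x x0; apply: bl_scale_ge0 => //; apply: fp.2.
have P13 : P1 -> P3.
  move=> h; apply: rank_oneP3 => f y fd fp y0; apply: (h (rank_one fd y)).
  - exact: rank_one_continuous.
  - exact: rank_one_pos.
  - exact: rank_one_dunford_pettis.
have P23 : P2 -> P3.
  move=> h; apply: rank_oneP3 => f y fd fp y0; apply: (h (rank_one fd y)).
  - exact: rank_one_continuous.
  - exact: rank_one_pos.
  - exact: rank_one_compact.
have norm0 (T : E -> F) (x : nat -> E) : T \o x @ \oo --> (0 : F) ->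
    (fun n => `|T (x n)|) @ \oo --> (0 : R).
  by move=> h; rewrite -(normr0 F); apply: (cvg_norm h).
have triv (T : {linear E -> F}) : (forall y : F, y = 0) -> uaw_dunford_pettis LE T.
  move=> F0 x _ _; apply: norm0; rewrite (_ : _ \o _ = fun=> 0); first exact: cvg_cst.
  by apply/funext => n; exact: F0.
have P31 : P3 -> P1.
  move=> [oc|F0] T Tc _ Tdp; last exact: triv.
  move=> x [M xM] xuaw; apply: norm0; apply: Tdp.
  exact: (uaw_null_weakly_null (dual_oc_ball_almost_order_bounded oc) xM xuaw).
have P32 : P3 -> P2.
  move=> [oc|F0] T Tc _ Tk; last exact: triv.
  move=> x [M xM] xuaw; apply: norm0; apply: (compact_op_weakly_null Tc Tk xM).
  exact: (uaw_null_weakly_null (dual_oc_ball_almost_order_bounded oc) xM xuaw).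
by split; split; [move/P13/P32|move/P23/P31|move/P23|move/P32].
Qed.
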